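(* Let $n \geq 0$ and $0 \leq k \leq n$ be integers. The poset $\Omega_{n,k}$ has the Boolean algebra decomposition $$\Omega_{n,k} = \bigcup_{v \in \Omega''_{n,k}} [v, \psi(v)],$$ that is, $\Omega_{n,k}$ is the union of the intervals $[v,\psi(v)]$ for $v \in \Omega''_{n,k}$, these intervals are pairwise disjoint, and each is isomorphic to a Boolean algebra.
   Context: $\Omega_{n,k}$ is the set of all words $w = w_1 w_2 \cdots w_n$ of length $n$ over $\{0,1\}$ with exactly $n-k$ zeroes and $k$ ones. It is made into a graded poset by declaring the cover relations to be $u \circ 01 \circ v \prec u \circ 10 \circ v$ for words $u,v$, where $\circ$ denotes concatenation, and taking the partial order generated by them. Intervals $[x,y]=\{z : x\le z\le y\}$ are taken in this poset. $\Omega''_{n,k}$ is the set of words $v \in \Omega_{n,k}$ with $v_1 \leq v_2$, $v_3 \leq v_4$, $\ldots$, $v_{2\lfloor n/2\rfloor -1} \leq v_{2\lfloor n/2 \rfloor}$ (no condition on $v_n$ when $n$ is odd). For $w \in \Omega_{n,k}$, $\psi(w)$ is the word $\max(w_1,w_2),\min(w_1,w_2),\max(w_3,w_4),\min(w_3,w_4),\ldots$, i.e. each pair of positions $(2i-1,2i)$ is sorted in decreasing order, and when $n$ is odd the last entry $w_n$ stays in place. *)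

(* Defs.v *)
From HB Require Import structures.
From mathcomp Require Import all_boot all_order.
From mathcomp Require Import interval.

Set Implicit Arguments.
Unset Strict Implicit.
Unset Printing Implicit Defensive.

Import Order.TTheory.

Local Open Scope order_scope.

(* Letters 0 and 1 are [false] and [true], so that the library order on [bool]
   is 0 <= 1; having [k] ones among [n] letters forces [n - k] zeroes. *)
Record Omega (n k : nat) := MkOmega {
  word :> n.-tuple bool;
  word_ones : count_mem true word == k }.

HB.instance Definition _ n k := [isSub of Omega n k for @word n k].
HB.instance Definition _ n k := [Finite of Omega n k by <:].

Definition omega_cover n k : rel (Omega n k) := fun x y =>
  [exists i : 'I_n, let u := take i x in let v := drop i.+2 x in
     (x == u ++ [:: false; true] ++ v :> seq bool) &&
     (y == u ++ [:: true; false] ++ v :> seq bool)].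

Lemma omega_coverP n k (x y : Omega n k) :
  reflect (exists u v : seq bool,
             x = u ++ [:: false; true] ++ v :> seq bool /\
             y = u ++ [:: true; false] ++ v :> seq bool)
          (omega_cover x y).
Proof.
apply: (iffP existsP) => [[i /andP[/eqP hx /eqP hy]]|[u [v [hx hy]]]].
  by exists (take i x), (drop i.+2 x).
have lt_un : (size u < n)%N.
  by rewrite -(size_tuple (word x)) hx size_cat /= -addSnnS leq_addr.
have eu : take (size u) x = u by rewrite hx take_size_cat.
have ev : drop (size u).+2 x = v.
  by rewrite hx -addn2 addnC -drop_drop drop_size_cat //= drop0.
by exists (Ordinal lt_un); rewrite /= eu ev hx hy !eqxx.
Qed.

Definition omega_le n k : rel (Omega n k) := connect (@omega_cover n k).

(* Number of pairs of positions [i < j] with a one in position [i]: it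
   increases by exactly 1 along each cover relation. *)
Fixpoint wt (s : seq bool) : nat :=
  if s is a :: s' then ((if a then size s' else 0) + wt s')%N else 0%N.

Lemma wt_cover n k (x y : Omega n k) : omega_cover x y -> wt y = (wt x).+1.
Proof.
case/omega_coverP => u [v [-> ->]] {x y}.
elim: u => [|a u IHu] /=; first by rewrite !add0n.
by rewrite IHu !size_cat /= addnS.
Qed.

Lemma wt_le n k (x y : Omega n k) : omega_le x y -> x = y \/ (wt x < wt y)%N.
Proof.
case/connectP => p; elim: p x => [|z p IHp] x /=; first by left.
case/andP => /wt_cover xz zp yE; right.
by case: (IHp z zp yE) => [<-|]; rewrite xz // => /ltnW.
Qed.

Lemma omega_le_refl n k : reflexive (@omega_le n k).
Proof. by move=> x; apply: connect0. Qed.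

Lemma omega_le_anti n k : antisymmetric (@omega_le n k).
Proof.
move=> x y /andP[/wt_le[//|lt_xy] /wt_le[//|lt_yx]].
by have := ltn_trans lt_xy lt_yx; rewrite ltnn.
Qed.

Lemma omega_le_trans n k : transitive (@omega_le n k).
Proof. by move=> y x z; apply: connect_trans. Qed.

Fact omega_display : Order.disp_t. Proof. exact: Order.Disp tt tt. Qed.

HB.instance Definition _ n k :=
  Order.Le_isPOrder.Build omega_display (Omega n k)
    (@omega_le_refl n k) (@omega_le_anti n k) (@omega_le_trans n k).

(* With 0-based positions, the pair (2i-1, 2i) is (2i, 2i+1) for i < n/2. *)
Definition Omega'' (n k : nat) : {set Omega n k} :=
  [set v : Omega n k | [forall i : 'I_n./2,
     nth false v i.*2 <= nth false v i.*2.+1]].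

Fixpoint psi_seq (s : seq bool) : seq bool :=
  if s is a :: b :: s' then Order.max a b :: Order.min a b :: psi_seq s'
  else s.

Lemma perm_psi_seq s : perm_eq (psi_seq s) s.
Proof.
have [m] := ubnP (size s); elim: m s => // m IHm [|a [|b s]] //= /ltnW sm.
rewrite -[X in perm_eq X _]/([:: Order.max a b; Order.min a b] ++ psi_seq s).
rewrite -[X in perm_eq _ X]/([:: a; b] ++ s).
by apply: perm_cat; [case: a b {sm} => [] [] | apply: IHm].
Qed.

Lemma size_psi_seq n (s : n.-tuple bool) : size (psi_seq s) == n.
Proof. by rewrite (perm_size (perm_psi_seq s)) size_tuple. Qed.

Lemma ones_psi_seq n k (w : Omega n k) :
  count_mem true (Tuple (size_psi_seq w)) == k.
Proof. by rewrite /= (permP (perm_psi_seq w)) (word_ones w). Qed.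

Definition psi n k (w : Omega n k) : Omega n k := MkOmega (ones_psi_seq w).

(* The finite Boolean algebras are the posets of all subsets of {0,...,m-1}
   ordered by inclusion. *)
Definition boolean_algebra_iso d (T : finPOrderType d) (A : {set T}) : Prop :=
  exists (m : nat) (f : T -> {set 'I_m}),
    [/\ {in A &, injective f},
        f @: A = [set: {set 'I_m}] &
        {in A &, forall x y, (f x \subset f y) = (x <= y)}].

(* Main.v *)
Require Import Defs.
From mathcomp Require Import all_boot all_order interval.

(** Let [asc] sort every pair of positions increasingly. Prefix sums of ones
    are monotone in the order, and those of even length agree on [v] and
    [psi v]; hence for [v] in [Omega''] the interval [[v, psi v]] is the fiber
    of [asc] over [v]. The fibers of [asc] partition [Omega n k]. Inside a
    fiber, a word is determined by the pairs 01 of [v] that it turns into 10,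
    these can be chosen freely, and the order is inclusion of the choices. *)

Set Implicit Arguments.
Unset Strict Implicit.
Unset Printing Implicit Defensive.

Import Order.TTheory.

Local Open Scope order_scope.

Lemma seq_ind_pair (T : Type) (P : seq T -> Prop) :
  P [::] -> (forall a, P [:: a]) ->
  (forall a b s, P s -> P [:: a, b & s]) -> forall s, P s.
Proof.
move=> P0 P1 P2 s; have [m] := ubnP (size s).
elim: m s => // m IHm [|a [|b s]] //= /ltnW sm.
exact/P2/IHm.
Qed.

Fixpoint asc (s : seq bool) : seq bool :=
  if s is a :: b :: s' then Order.min a b :: Order.max a b :: asc s' else s.

Lemma perm_asc s : perm_eq (asc s) s.
Proof.
elim/seq_ind_pair: s => //= a b s IHs.
rewrite -[X in perm_eq X _]/([:: Order.min a b; Order.max a b] ++ asc s).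
rewrite -[X in perm_eq _ X]/([:: a; b] ++ s).
by apply: perm_cat IHs; case: a b => [] [].
Qed.

Lemma psi_seq_asc s : psi_seq (asc s) = psi_seq s.
Proof. by elim/seq_ind_pair: s => //= a b s ->; case: a b => [] []. Qed.

Lemma asc_idem s : asc (asc s) = asc s.
Proof. by elim/seq_ind_pair: s => //= a b s ->; case: a b => [] []. Qed.

Lemma asc_psi_seq s : asc (psi_seq s) = asc s.
Proof. by elim/seq_ind_pair: s => //= a b s ->; case: a b => [] []. Qed.

Lemma asc_idP s :
  reflect (forall i, (i < (size s)./2)%N ->
             nth false s i.*2 <= nth false s i.*2.+1)
          (asc s == s).
Proof.
apply: (iffP eqP).
  elim/seq_ind_pair: s => //= a b s IHs [ha hb /IHs hs] [|i] /=.
    by case: a b ha hb => [] [].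
  by rewrite ltnS => /hs.
elim/seq_ind_pair: s => //= a b s IHs hs.
rewrite IHs => [|i hi]; last exact: (hs i.+1).
by have := hs 0 isT; case: a b {hs} => [] [].
Qed.

(** A pair of equal letters has a single arrangement, so sorting leaves it alone. Past the last full
    pair, position [i.*2] holds the unpaired letter or yields the default [false]. *)
Lemma nth_asc_fixed s i :
  ~~ ((i < (size s)./2)%N &&
      (nth false (asc s) i.*2 != nth false (asc s) i.*2.+1)) ->
  nth false s i.*2 = nth false (asc s) i.*2.
Proof.
elim/seq_ind_pair: s i => [|a|a b s IHs] // [|i] /=; last exact: IHs.
by case: a b => [] [].
Qed.

(** Gives surjectivity onto the Boolean algebra: each mixed pair can be oriented on its own, without
    changing the sorted word. *)
Lemma asc_fiber_choice (p : nat -> bool) s :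
  exists2 t, asc t = asc s &
    forall i, (i < (size s)./2)%N ->
      nth false (asc s) i.*2 != nth false (asc s) i.*2.+1 ->
      nth false t i.*2 = p i.
Proof.
elim/seq_ind_pair: s p => [|a|a b s IHs] p; [by exists [::] | by exists [:: a] |].
have [t tE tp] := IHs (p \o succn).
exists (if a != b then [:: p 0, ~~ p 0 & t] else [:: a, b & t]).
  by case: a b (p 0) => [] [] [] /=; rewrite tE.
by case=> [|i] /=; [case: a b => [] [] | case: ifP => _; apply: tp].
Qed.

Definition prefix_dom (s t : seq bool) :=
  forall i, (count_mem true (take i s) <= count_mem true (take i t))%N.

Lemma prefix_dom_cons2 (a b c d : bool) s t :
  (a + b = c + d)%N -> prefix_dom [:: a, b & s] [:: c, d & t] -> prefix_dom s t.
Proof.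
move=> e h i; have := h i.+2; move: e; case: a b c d {h} => [] [] [] [] //=;
by rewrite ?add0n ?add1n ?ltnS.
Qed.

(** A cover changes only the prefix that ends between the two swapped letters, and that prefix gains
    a one. *)
Lemma omega_le_prefix n k (x y : Omega n k) : x <= y -> prefix_dom x y.
Proof.
case/connectP => p; elim: p x => [|z p IHp] x /=; first by move=> _ ->.
case/andP => /omega_coverP[u [v [xE zE]]] /IHp zy /zy {}zy i.
apply: leq_trans (zy i); rewrite xE zE; elim: u i {xE zE} => [|a u IHu] [|i] //=.
  by case: i => [|i] //=; rewrite ?take0.
by rewrite leq_add2l IHu.
Qed.

Lemma asc_between v z :
  size v = size z -> asc v = v -> prefix_dom v z -> prefix_dom z (psi_seq v) ->
  asc z = v.
Proof.
elim/seq_ind_pair: v z => [|a|a b v IHv] [|c [|d z]] //=.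
  move=> _ _ /(_ 1) + /(_ 1) /=.
  by case: a c => [] [].
case=> sz [ha hb vE] vz zv.
(* [v] and [psi_seq v] have equally many ones among their first two letters, which squeezes the
   count for [z]. *)
have e : (a + b = c + d)%N.
  have := vz 2; have := zv 2; rewrite /= ?take0 /=.
  by case: a b c d {vz zv} ha hb => [] [] [] [].
rewrite (IHv z) //.
- by case: a b c d {vz zv} ha hb e => [] [] [] [].
- exact: prefix_dom_cons2 vz.
- apply: prefix_dom_cons2 zv; rewrite -e.
  by case: a b {vz e} ha hb => [] [].
Qed.

(** Corresponding pairs have equal sums, so the prefixes of length [i.*2] hold equally many ones;
    the prefixes one letter longer then compare the letters at [i.*2]. *)
Lemma asc_prefix_dom_nth s t i :
  asc s = asc t -> prefix_dom s t -> nth false s i.*2 <= nth false t i.*2.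
Proof.
elim/seq_ind_pair: s t i => [|a|a b s IHs] [|c [|d t]] //= i.
  by case=> ->.
case=> hm hM /IHs IH st; have e : (a + b = c + d)%N.
  by case: a b c d hm hM {st} => [] [] [] [].
case: i => [|i] /=; last exact: IH (prefix_dom_cons2 e st).
by have := st 1; rewrite /= ?take0 /=; case: a c {hm hM st e} => [] [].
Qed.

Lemma Omega_of_perm n k (x : Omega n k) s :
  perm_eq s x -> exists y : Omega n k, y = s :> seq bool.
Proof.
move=> sx; have sz : size s == n by rewrite (perm_size sx) size_tuple.
have ct : count_mem true (Tuple sz) == k by rewrite /= (permP sx) (word_ones x).
by exists (MkOmega ct).
Qed.

Lemma Omega_inj n k (x y : Omega n k) : x = y :> seq bool -> x = y.
Proof. by move=> e; apply/val_inj/val_inj. Qed.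

(** Climbs from [x] to [y] one pair at a time, from left to right; [u] collects the pairs that
    already agree with [y]. *)
Lemma omega_le_asc_cat n k s t u (x y : Omega n k) :
  x = u ++ s :> seq bool -> y = u ++ t :> seq bool -> asc s = asc t ->
  (forall i, nth false s i.*2 <= nth false t i.*2) -> x <= y.
Proof.
elim/seq_ind_pair: s t u x => [|a|a b s IHs] [|c [|d t]] u x //= xE yE.
- by move=> _ _; rewrite (Omega_inj (etrans xE (esym yE))).
- by case=> ac _; rewrite (@Omega_inj _ _ x y) // xE yE ac.
case=> hm hM st le; have le0 := le 0.
(* [w] is [x] with its first pair after [u] replaced by that of [y]. *)
have [|w wE] := @Omega_of_perm n k x (u ++ [:: c, d & s]).
  rewrite xE perm_cat2l -[X in perm_eq X _]/([:: c; d] ++ s).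
  rewrite -[X in perm_eq _ X]/([:: a; b] ++ s) perm_cat2r.
  by case: a b c d {xE yE le le0} hm hM => [] [] [] [].
apply: (@le_trans _ _ w); last first.
  apply: (IHs t (u ++ [:: c; d])); rewrite -?catA //.
  by move=> i; apply: (le i.+1).
have [xw|nxw] := eqVneq x w; first by rewrite xw.
apply/connect1/omega_coverP; exists u, s; rewrite xE wE.
have : [:: a; b] != [:: c; d].
  by apply: contraNneq nxw => -[ac bd]; apply/eqP/Omega_inj; rewrite xE wE ac bd.
(* Two distinct pairs with the same sorted form and [a <= c] must be 01 and 10. *)
by move: le0 hm hM; rewrite /=; clear; case: a b c d => [] [] [] [].
Qed.

Lemma omega_le_asc n k (x y : Omega n k) :
  asc x = asc y ->
  (x <= y) <-> (forall i, nth false x i.*2 <= nth false y i.*2).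
Proof.
move=> xy; split=> [/omega_le_prefix le i|]; first exact: asc_prefix_dom_nth.
exact: (@omega_le_asc_cat _ _ _ _ [::]).
Qed.

Lemma nth_psi_seq s i : nth false s i.*2 <= nth false (psi_seq s) i.*2.
Proof.
elim/seq_ind_pair: s i => [|a|a b s IHs] [|i] //=.
by case: a b => [] [].
Qed.

Lemma nth_asc s i : nth false (asc s) i.*2 <= nth false s i.*2.
Proof.
elim/seq_ind_pair: s i => [|a|a b s IHs] [|i] //=.
by case: a b => [] [].
Qed.

Lemma Omega''E n k (v : Omega n k) : (v \in Omega'' n k) = (asc v == v).
Proof.
rewrite inE; apply/forallP/asc_idP; rewrite size_tuple => h i.
  by move=> hi; apply: (h (Ordinal hi)).
exact: h.
Qed.

Lemma interval_psiE n k (v z : Omega n k) :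
  v \in Omega'' n k -> (z \in `[v, psi v]) = (asc z == v).
Proof.
rewrite Omega''E in_itv /= => /eqP vE; apply/andP/eqP => [[vz zv]|zE].
  apply: asc_between; rewrite ?size_tuple //; first exact: omega_le_prefix.
  exact: (omega_le_prefix zv).
split.
  by apply/omega_le_asc => [|i]; rewrite ?vE // -zE nth_asc.
apply/omega_le_asc => [|i]; rewrite /= ?asc_psi_seq ?vE //.
by rewrite -zE psi_seq_asc nth_psi_seq.
Qed.

Lemma interval_psi_boolean n k (v : Omega n k) :
  v \in Omega'' n k -> boolean_algebra_iso [set z in `[v, psi v]].
Proof.
move=> vO.
(* [A] indexes the 01 pairs of [v], and [f z] records which of them read 10 in [z]. *)
pose A := [set i : 'I_n./2 | nth false v i.*2 != nth false v i.*2.+1].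
pose f (z : Omega n k) := [set j : 'I_#|A| | nth false z (enum_val j).*2].
have fiber z : (z \in [set z in `[v, psi v]]) = (asc z == v).
  by rewrite inE interval_psiE.
have f_le : {in [set z in `[v, psi v]] &,
    forall x y, (f x \subset f y) = (x <= y)}.
  move=> x y; rewrite !fiber => /eqP xE /eqP yE.
  have le_xy := omega_le_asc (etrans xE (esym yE)).
  apply/subsetP/idP => [sub|/le_xy le j]; last first.
    by rewrite !inE => xj; have := le (enum_val j); rewrite xj; case: nth.
  apply/le_xy => i.
  have [/andP[hi vi]|nA] := boolP ((i < n./2)%N &&
      (nth false v i.*2 != nth false v i.*2.+1)).
    have iA : Ordinal hi \in A by rewrite inE.
    have := sub (enum_rank_in iA (Ordinal hi)).
    by rewrite !inE enum_rankK_in //=; case: (nth _ x _) => // ->.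
  (* Outside [A], both first letters equal that of [v]. *)
  by rewrite (@nth_asc_fixed x) ?xE ?(@nth_asc_fixed y) ?yE ?size_tuple.
exists #|A|, f; split=> //.
- move=> x y xI yI fE; apply/eqP; rewrite eq_le.
  by rewrite -(f_le x y) // -(f_le y x) // fE subxx.
- apply/setP => S; rewrite in_setT.
  (* [p] is the indicator of [S], carried from ranks in [A] back to pair indices. *)
  pose p i := [exists j in S, enum_val j == i :> nat].
  have [t tE tp] := asc_fiber_choice p v.
  have vE : asc v = v by move: vO; rewrite Omega''E => /eqP.
  have [|z zE] := @Omega_of_perm _ _ v t.
    by rewrite -vE -tE perm_sym perm_asc.
  apply/imsetP; exists z; first by rewrite fiber zE tE vE.
  apply/setP => j; rewrite inE zE tp.
  + apply/idP/existsP => [jS|[l /andP[lS /eqP/val_inj/enum_val_inj <-//]]].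
    by exists j; rewrite jS /=.
  + by rewrite size_tuple.
  + by rewrite vE; have := enum_valP j; rewrite inE.
Qed.

Theorem theorem2p2 (n k : nat) (hk : (k <= n)%N) :
  [/\ [set: Omega n k] = \bigcup_(v in Omega'' n k) [set z in `[v, psi v]],
      {in Omega'' n k &, forall v w : Omega n k, v != w ->
         [disjoint [set z in `[v, psi v]] & [set z in `[w, psi w]]]} &
      {in Omega'' n k, forall v : Omega n k,
         boolean_algebra_iso [set z in `[v, psi v]]}].
Proof.
split.
- apply/setP => z; rewrite in_setT; apply/esym/bigcupP.
  have [v vE] := Omega_of_perm (perm_asc z).
  have vO : v \in Omega'' n k by rewrite Omega''E vE asc_idem.
  by exists v; rewrite // inE interval_psiE // vE.
- move=> v w vO wO; apply: contraNT => /pred0Pn[z /andP[]].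
  rewrite /= 2!in_set !interval_psiE // => /eqP vE /eqP wE.
  by apply/eqP/Omega_inj; rewrite -vE -wE.
- exact: interval_psi_boolean.
Qed.
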